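(* Let $t_f>0$, $C>0$, $a>0$, $b>0$ be constants and let the average travel time in the network at flow $x\ge 0$ be $$t(x)=t_f\left(1+a\left(\frac{x}{C}\right)^b\right).$$ Then the flow-accumulation relation $x(n)$, $n\ge 0$, is increasing in the accumulation $n$ and is concave with respect to $n$.
   Context: For a network flow $x\ge 0$, the accumulation (total number of vehicles in the network) is $n(x)=x\,t(x)$. The flow-accumulation relation $n\mapsto x(n)$ on $[0,\infty)$ is the inverse function of $x\mapsto n(x)=x\,t(x)$ on $[0,\infty)$, i.e. $x(n)\ge 0$ is the flow with $x(n)\,t(x(n))=n$. *)

(* Defs.v *)
From HB Require Import structures.
From mathcomp Require Import all_boot all_order all_algebra.
From mathcomp Require Import all_classical all_reals all_analysis.

Set Implicit Arguments.
Unset Strict Implicit.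
Unset Printing Implicit Defensive.

Import Order.TTheory GRing.Theory Num.Theory.
Import numFieldNormedType.Exports.

Local Open Scope classical_set_scope.
Local Open Scope ring_scope.

(* [powR] is used because the exponent [b] is an arbitrary positive real; for
   [b != 0] it satisfies [0 `^ b = 0], so that [travel_time tf C a b 0 = tf]. *)
Definition travel_time (R : realType) (tf C a b x : R) : R :=
  tf * (1 + a * (x / C) `^ b).

Definition accumulation (R : realType) (tf C a b x : R) : R :=
  x * travel_time tf C a b x.

(* For positive parameters, [accumulation tf C a b] is a bijection of [0, +oo[
   onto itself, so the default value [0] of the partial inverse is irrelevant
   on [0, +oo[. *)
Definition flow_of_accumulation (R : realType) (tf C a b : R) : R -> R :=
  'pinv_(fun=> 0) (`[0, +oo[ : set R) (accumulation tf C a b).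

Definition concave_function (R : numFieldType) (E : lmodType R) (D : set E)
  (f : E -> R^o) : Prop := convex_function D (\- f).

(* Main.v *)
Require Import Defs.
From mathcomp Require Import all_boot all_order all_algebra.
From mathcomp Require Import all_classical all_reals all_analysis unstable ring.
Import Order.TTheory GRing.Theory Num.Theory.
Import numFieldNormedType.Exports.
Local Open Scope classical_set_scope.
Local Open Scope ring_scope.

(* On [0, +oo[ the accumulation is [tf * x + K * x `^ (b + 1)] with [K > 0],
   a strictly increasing convex bijection of [0, +oo[; the inverse of an
   increasing convex bijection is increasing and concave. *)

(** Differentiability gives continuity at every [x > 0] but can fail at [0] when [p < 1], so the
    endpoint is settled by a one-sided limit. *)
Lemma within_continuous_powR (R : realType) (p : R) : 0 < p ->
  {within `[0, +oo[, continuous (@powR R ^~ p)}.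
Proof.
move=> p0; apply/continuous_within_itvcyP; split; last first.
  by rewrite powR0 ?gt_eqF//; exact: powR_cvg0.
move=> x x0; apply: differentiable_continuous.
exact/derivable1_diffP/derivable_powR.
Qed.

Lemma convR_ge0 (R : numFieldType) (t : {i01 R}) (x y : R^o) :
  0 <= x -> 0 <= y -> 0 <= conv t x y.
Proof. by move=> x0 y0; rewrite convRE addr_ge0// mulr_ge0// onem_ge0. Qed.

Section increasing_convex_bijection.
Context {R : realType} (F : R -> R).
Hypothesis F_incr : {in `[0, +oo[ &, {mono F : x y / x <= y}}.
Hypothesis F_bij : set_bij `[0, +oo[ `[0, +oo[ F.

Let G := 'pinv_(fun=> 0) (`[0, +oo[ : set R) F.

Let GK (n : R) : 0 <= n -> F (G n) = n.
Proof.
move=> n0; apply: pinvK; rewrite inE.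
by apply: (set_bij_surj F_bij); rewrite /= in_itv/= n0.
Qed.

Let G_ge0 (n : R) : 0 <= n -> 0 <= G n.
Proof.
move=> n0; have /set_bij_sub := bijpinv_bij (fun=> 0) F_bij.
by move=> /(_ (G n)) /=; rewrite in_itv/= andbT; apply; exists n => //;
  rewrite /= in_itv/= n0.
Qed.

(** [F] reflects the strict order, and [F (G n) = n]. *)
Lemma pinv_increasing : {in `[0, +oo[ &, {homo G : n1 n2 / n1 < n2}}.
Proof.
move=> n1 n2; rewrite !in_itv/= !andbT => n10 n20 n12.
by rewrite -(leW_mono_in F_incr) ?in_itv/= ?G_ge0// !GK.
Qed.

(** Applying the increasing [F] to both sides of the concavity inequality for [G] leaves the
    convexity inequality of [F] at the points [G n1] and [G n2]. *)
Lemma pinv_concave : convex_function (`[0, +oo[ : set R^o) F ->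
  concave_function (`[0, +oo[ : set R^o) G.
Proof.
move=> F_convex t n1 n2; rewrite !inE/= !in_itv/= !andbT => n10 n20.
rewrite -convN lerN2.
rewrite -F_incr ?in_itv/= ?andbT ?G_ge0 ?convR_ge0 ?G_ge0//.
(* Only the [n1] and [n2] on the right-hand side become [F (G n1)] and [F (G n2)]. *)
rewrite GK ?convR_ge0// -{2}(GK _ n10) -{2}(GK _ n20).
by apply: F_convex; rewrite inE/= in_itv/= G_ge0.
Qed.

End increasing_convex_bijection.

Section accumulation.
Context {R : realType} (tf C a b : R).
Hypotheses (tf_gt0 : 0 < tf) (C_gt0 : 0 < C) (a_gt0 : 0 < a) (b_gt0 : 0 < b).

Let K := tf * a * C^-1 `^ b.
Let p := b + 1.

Let K_gt0 : 0 < K.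
Proof. by rewrite !mulr_gt0// powR_gt0// invr_gt0. Qed.

Let p_gt0 : 0 < p.
Proof. by rewrite addr_gt0. Qed.

Lemma accumulationE (x : R) : 0 <= x ->
  accumulation tf C a b x = tf * x + K * x `^ p.
Proof.
move=> x0; rewrite /accumulation /travel_time powRM ?invr_ge0 ?(ltW C_gt0)//.
(* Since [b + 1] is nonzero, the exponent law holds at [x = 0] too. *)
rewrite /K /p powRD ?(gt_eqF p_gt0)// powRr1//.
by ring.
Qed.

Lemma accumulation_increasing :
  {in `[0, +oo[ &, {mono accumulation tf C a b : x y / x <= y}}.
Proof.
apply: le_mono_in => x y.
rewrite !in_itv/= !andbT => x0 y0 xy; rewrite !accumulationE//.
by rewrite ltrD// ltr_pM2l// gt0_ltr_powR.
Qed.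

Lemma accumulation_bij :
  set_bij `[0, +oo[ `[0, +oo[ (accumulation tf C a b).
Proof.
split.
- move=> x /=; rewrite !in_itv/= !andbT => x0.
  by rewrite accumulationE// addr_ge0// mulr_ge0 ?powR_ge0 ?(ltW K_gt0) ?(ltW tf_gt0).
- by move=> x y; rewrite !inE; exact: (inc_inj_in accumulation_increasing).
- move=> n /=; rewrite in_itv/= andbT => n0.
  pose f x := tf * x + K * x `^ p.
  (* Surjectivity comes from the intermediate value theorem on [[0, n / tf]]: at the right end the
     linear term alone already equals [n]. *)
  have ntf0 : 0 <= n / tf by rewrite divr_ge0 ?(ltW tf_gt0).
  have f0 : f 0 = 0 by rewrite /f powR0 ?gt_eqF// !mulr0 addr0.
  have nf : n <= f (n / tf).
    by rewrite /f mulrCA divff ?gt_eqF// mulr1 lerDl mulr_ge0 ?powR_ge0 ?(ltW K_gt0).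
  have f_cont : {within `[0, +oo[, continuous f}.
    move=> x; apply: cvgD; apply: cvgMr; last exact: within_continuous_powR.
    by apply: continuous_subspaceT => ?; exact: cvg_id.
  have {}f_cont : {within `[0, n / tf], continuous f}.
    by apply: continuous_subspaceW f_cont; exact: subset_itvl.
  have [|x] := IVT ntf0 f_cont (v := n).
    by rewrite f0 ge_min n0 le_max nf orbT.
  rewrite in_itv/= => /andP[x0 _] fx; exists x; first by rewrite /= in_itv/= x0.
  by rewrite accumulationE.
Qed.

Lemma accumulation_convex :
  convex_function (`[0, +oo[ : set R^o) (accumulation tf C a b).
Proof.
move=> t x y xD yD; have := convex_powR (p := p) _ t xD yD.
move: xD yD; rewrite !inE/= !in_itv/= !andbT => x0 y0 /(_ _).
rewrite !accumulationE//; last exact: convR_ge0.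
(* Convexity of the power requires [1 <= p], which amounts to [0 <= b]. *)
rewrite lerDr (ltW b_gt0) => /(_ isT) powp_convex.
set z := conv t x y in powp_convex *.
have zE : z = t%:num * x + t%:num.~ * y by [].
(* The inequality for the power is scaled by [K] and the linear term [tf * z] is added; as that term
   is affine in [z], what remains is an equality. *)
move: powp_convex; rewrite -(ler_pM2l K_gt0) -(lerD2l (tf * z)) => /le_trans.
apply; rewrite zE !convRE /=.
by rewrite le_eqVlt; apply/orP; left; apply/eqP; rewrite /onem; ring.
Qed.

End accumulation.

Theorem theorem1 (R : realType) (tf C a b : R)
    (htf : 0 < tf) (hC : 0 < C) (ha : 0 < a) (hb : 0 < b) :
  {in `[0, +oo[ &,
    {homo flow_of_accumulation tf C a b : n1 n2 / n1 < n2}} /\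
  concave_function (`[0, +oo[ : set R^o) (flow_of_accumulation tf C a b).
Proof.
have F_incr := accumulation_increasing _ _ _ _ htf hC ha hb.
have F_bij := accumulation_bij _ _ _ _ htf hC ha hb.
split; first exact: pinv_increasing.
exact/pinv_concave/accumulation_convex.
Qed.
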